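(* Let $K$ be a natural number, $l>0$, and let $g:F_{\omega,K}\to l$ be a finite coloring that is Baire measurable (each color class has the Baire property) relative to the topology on $F_{\omega,K}$ whose basic open sets are $$[(t,i)]=\{(s,j)\in F_{\omega,K}:(s\upharpoonright L,\ j\upharpoonright K)=(t,i)\},\qquad (t,i)\in F_{L,K},\ K<L<\omega.$$ Then there exists $(r,c)\in F_{\omega,\omega}$ such that the set $[(r,c)]_K=\{(s,j)\in F_{\omega,K}:(s,j)\le(r,c)\}$ is $g$-monochromatic.
   Context: Conventions: $\omega=\{0,1,2,\dots\}$, each natural number $n$ is identified with $\{0,\dots,n-1\}$. For $K\le L\le\omega$, $F_{L,K}$ is the set of pairs $(r,c)$ with $r:L\to K$, $c:K\to L$ strictly increasing, such that for all $x\in K$, $y\in L$: $r(c(x))=x$, and $y\le c(x)\Rightarrow r(y)\le x$. Composition: $(s,j)\cdot(r,c)=(s\circ r,\,c\circ j)\in F_{M,K}$ for $(s,j)\in F_{L,K}$, $(r,c)\in F_{M,L}$. For $(s,j)\in F_{\omega,K}$ and $(r,c)\in F_{\omega,\omega}$, $(s,j)\le(r,c)$ ($(s,j)$ is a reduct of $(r,c)$) means $(s,j)=(s',j')\cdot(r,c)$ for some $(s',j')\in F_{\omega,K}$. *)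

(* Defs.v *)
From HB Require Import structures.
From mathcomp Require Import all_boot.
From mathcomp Require Import boolp classical_sets filter topology.

Set Implicit Arguments.
Unset Strict Implicit.
Unset Printing Implicit Defensive.

Local Open Scope classical_set_scope.

(* The ordinals below omega + 1. *)
Inductive upto_omega := Fin of nat | Omega.

Definition seg (M : upto_omega) : Type := if M is Fin n then 'I_n else nat.

Definition segval (M : upto_omega) : seg M -> nat :=
  if M is Fin n return seg M -> nat then @nat_of_ord n else id.

(* The set F_{L,K} of pairs (r, c).  The requirement K <= L is implied by the
   existence of a strictly increasing c : K -> L, so it is not a field: for
   K > L the type is empty. *)
Record connection (L K : upto_omega) := Connection {
  surj : seg L -> seg K;
  inj : seg K -> seg L;
  inj_incr : forall x x' : seg K,
    segval x < segval x' -> segval (inj x) < segval (inj x');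
  injK : forall x : seg K, surj (inj x) = x;
  surj_le : forall (x : seg K) (y : seg L),
    segval y <= segval (inj x) -> segval (surj y) <= segval x
}.

HB.instance Definition _ (L K : upto_omega) := gen_eqMixin (connection L K).
HB.instance Definition _ (L K : upto_omega) := gen_choiceMixin (connection L K).

Section Composition.
Variables (M L K : upto_omega) (p : connection L K) (q : connection M L).

Let comp_incr (x x' : seg K) : segval x < segval x' ->
  segval ((inj q \o inj p) x) < segval ((inj q \o inj p) x').
Proof. by move=> xx'; apply/inj_incr/inj_incr. Qed.

Let compK (x : seg K) : (surj p \o surj q) ((inj q \o inj p) x) = x.
Proof. by rewrite /= !injK. Qed.

Let comp_le (x : seg K) (y : seg M) : segval y <= segval ((inj q \o inj p) x) ->
  segval ((surj p \o surj q) y) <= segval x.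
Proof. by move=> yx; apply/surj_le/surj_le. Qed.

(* (s, j) . (r, c) = (s o r, c o j) for p = (s, j) and q = (r, c). *)
Definition conn_comp : connection M K := Connection comp_incr compK comp_le.

End Composition.

Definition reduct (K : upto_omega)
    (p : connection Omega K) (q : connection Omega Omega) : Prop :=
  exists p' : connection Omega K, p = conn_comp p' q.

(* [q]_K *)
Definition reducts (K : upto_omega) (q : connection Omega Omega) :
  set (connection Omega K) := [set p | reduct p q].
Arguments reducts : clear implicits.

(* [(t, i)], where inj p : K -> omega and i : K -> L are compared as functions
   into omega. *)
Definition cylinder (K L : nat) (t : connection (Fin L) (Fin K)) :
    set (connection Omega (Fin K)) :=
  [set p : connection Omega (Fin K) |
     (forall y : 'I_L, surj p (y : nat) = surj t y) /\
     (forall x : 'I_K, inj p x = nat_of_ord (inj t x))].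

Definition cylinders (K : nat) : set (set (connection Omega (Fin K))) :=
  [set A | exists (L : nat) (t : connection (Fin L) (Fin K)),
             K < L /\ A = cylinder t].

Lemma cylinder_exists (K : nat) (p : connection Omega (Fin K)) :
  exists (L : nat) (t : connection (Fin L) (Fin K)), K < L /\ cylinder t p.
Proof.
pose L := (K + \max_(x < K) (inj p x : nat)).+1.
have jL (x : 'I_K) : (inj p x : nat) < L.
  by rewrite ltnS (leq_trans _ (leq_addl _ _))//; exact: (leq_bigmax x).
pose i (x : 'I_K) : 'I_L := Ordinal (jL x).
pose t (y : 'I_L) : 'I_K := surj p (y : nat).
have iH (x x' : seg (Fin K)) : segval x < segval x' ->
    @segval (Fin L) (i x) < @segval (Fin L) (i x') by exact: (inj_incr p).
have tK (x : seg (Fin K)) : t (i x) = x by exact: (injK p).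
have tle (x : seg (Fin K)) (y : seg (Fin L)) :
    segval y <= @segval (Fin L) (i x) -> @segval (Fin K) (t y) <= segval x.
  exact: (surj_le (c := p)).
exists L, (@Connection (Fin L) (Fin K) t i iH tK tle).
by split=> //; rewrite ltnS leq_addr.
Qed.

Lemma cylinder_sub (K L L' : nat) (t : connection (Fin L) (Fin K))
    (t' : connection (Fin L') (Fin K)) (p : connection Omega (Fin K)) :
  L <= L' -> cylinder t p -> cylinder t' p -> cylinder t' `<=` cylinder t.
Proof.
move=> LL' [pt pi] [pt' pi'] q [qt' qi']; split=> [y|x].
  have := qt' (widen_ord LL' y); rewrite -pt' /= => ->; exact: pt.
by rewrite qi' -pi' pi.
Qed.

Lemma cylinders_cover (K : nat) : \bigcup_(A in @cylinders K) A = setT.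
Proof.
rewrite -subTset => p _; have [L [t [KL tp]]] := cylinder_exists p.
by exists (cylinder t) => //; exists L, t.
Qed.

Lemma cylinders_join (K : nat) (A B : set (connection Omega (Fin K)))
    (p : connection Omega (Fin K)) :
  cylinders A -> cylinders B -> A p -> B p ->
  exists C, [/\ cylinders C, C p & C `<=` A `&` B].
Proof.
move=> [L [t [KL ->]]] [L' [t' [KL' ->]]] tp tp'.
have [LL'|/ltnW LL'] := leqP L L'.
  exists (cylinder t'); split=> //; first by exists L', t'.
  by rewrite subsetI; split=> //; exact: (cylinder_sub LL' tp tp').
exists (cylinder t); split=> //; first by exists L, t.
by rewrite subsetI; split=> //; exact: (cylinder_sub LL' tp' tp).
Qed.

HB.instance Definition _ (K : nat) :=
  @isBaseTopological.Build (connection Omega (Fin K))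
    (set (connection Omega (Fin K))) (@cylinders K) id
    (@cylinders_cover K) (@cylinders_join K).

Definition nowhere_dense (T : topologicalType) (A : set T) : Prop :=
  interior (closure A) = set0.

Definition meager (T : topologicalType) (A : set T) : Prop :=
  exists N : nat -> set T,
    (forall n, nowhere_dense (N n)) /\ A `<=` \bigcup_n N n.

Definition baire_property (T : topologicalType) (A : set T) : Prop :=
  exists U : set T, open U /\ meager (A `+` U).

Definition baire_measurable (T : topologicalType) (l : nat) (g : T -> 'I_l) :
  Prop := forall a : 'I_l, baire_property (g @^-1` [set a]).

Definition monochromatic (T C : Type) (g : T -> C) (A : set T) : Prop :=
  exists a : C, forall x, A x -> g x = a.

(* Main.v *)
Require Import Defs.
From mathcomp Require Import all_boot zify.
From mathcomp Require Import boolp classical_sets filter topology.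

(** Call [last_inj p] the largest mark of [p = (s, j)] in [F_{omega,K}].

    A fusion in which every finite pattern is extended so as to avoid
    more and more of the meager sets and to decide the open sets attached to
    the color classes yields [q] such that the color of [p . q] depends only on
    [j] and on the values of [s] up to [last_inj p].

    Such colorings are then handled by induction on [K].  Once the restriction
    of [p] to its first [K - 1] letters is fixed up to its last mark, the color
    is a function of a finite word over the [K] letters, up to the last
    occurrence of the last letter.  An infinite Hales--Jewett theorem for words
    with a variable makes it constant on the reducts of some [q]; a fusion does
    so for all restrictions at once, and the color becomes a coloring for
    [K - 1].  The Hales--Jewett theorem comes from an ultrafilter [V] on words
    containing the variable with [V V = V] and [V(a) V = V] for all letters
    [a]. *)

Set Implicit Arguments.
Unset Strict Implicit.
Unset Printing Implicit Defensive.

Local Open Scope classical_set_scope.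

Local Notation QQ := (connection Omega Omega).
Local Notation FF k := (connection Omega (Fin k.+1)).

(** * Idempotents in compact semigroups *)

(** Zorn's lemma is applied to complements relative to [C0]. Along a chain the closed sets left over
    decrease, and compactness keeps their intersection nonempty. *)
Lemma minimal_closed (T : topologicalType) (C0 : set T) (P : set (set T)) :
  compact C0 -> closed C0 -> C0 !=set0 -> P C0 ->
  (forall F : set (set T), F `<=` P -> P (\bigcap_(C in F) C)) ->
  exists C, [/\ C `<=` C0, closed C, C !=set0, P C &
    forall D, D `<=` C -> closed D -> D !=set0 -> P D -> D = C].
Proof.
move=> cptC0 clC0 C0n0 PC0 PI.
pose Q C := [/\ C `<=` C0, closed C, C !=set0 & P C].
have [F FQ Ftot|X [QX Xmax]] := @Zorn_bigcup T [set X | Q (C0 `\` X)].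
  have [[X0 FX0]|F0] := pselect (F !=set0); last first.
    have -> : \bigcup_(X in F) X = set0.
      by apply: bigcup0 => X FX; exfalso; apply: F0; exists X.
    by rewrite /= setD0; split.
  have E : C0 `\` \bigcup_(X in F) X =
      \bigcap_(C in [set C0 `\` X | X in F]) C.
    apply/seteqP; split=> [x [C0x nFx] _ [X FX <-]|x Fx].
      by split=> // Xx; apply: nFx; exists X.
    split=> [|[X FX Xx]]; first by have [] : (C0 `\` X0) x by apply: Fx; exists X0.
    by have [_] : (C0 `\` X) x by apply: Fx; exists X.
  have clF : closed (C0 `\` \bigcup_(X in F) X).
    by rewrite E; apply: closed_bigI => _ [X /FQ[_ clX _ _] <-].
  split => //; last first.
    by rewrite E; apply: PI => _ [X /FQ[_ _ _ PX] <-].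
  pose G := filter_from F (fun X => C0 `\` X).
    have PG : ProperFilter G.
      apply: filter_from_proper; last by move=> X /FQ[].
      apply: filter_from_filter; first by exists X0.
      move=> X Y FX FY; have [XY|YX] := Ftot _ _ FX FY.
        by exists Y => // x [C0x nYx]; split; split=> // /XY.
      by exists X => // x [C0x nXx]; split; split=> // /YX.
    have [|x [C0x Gx]] := cptC0 _ PG.
      by exists X0 => // x [].
    exists x; split=> // -[X FX].
    have [_ clX _ _] := FQ _ FX.
    suff : (C0 `\` X) x by case.
    by apply: clX => B Bx; apply: Gx => //; exists X.
case: (QX) => _ clX Xn0 PX.
exists (C0 `\` X); split=> //.
move=> D DX clD Dn0 PD; apply/seteqP; split=> //; apply: contrapT => nXD.
apply: (Xmax (~` D)); last first.
  have DC0 : D `<=` C0 by move=> x /DX [].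
  by rewrite /= setDE setCK (setIidr DC0).
split=> [x Xx Dx|DCX]; first by case: (DX _ Dx).
by apply: nXD => x [C0x nXx]; apply: contrapT => /DCX.
Qed.

Section CompactSemigroup.
Variables (T : topologicalType) (op : T -> T -> T).
Hypothesis hT : hausdorff_space T.
Hypothesis opA : associative op.
Hypothesis op_cont : forall q, continuous (op^~ q).
Implicit Types C H I : set T.

Lemma closed_opr C q : compact C -> closed ((op^~ q) @` C).
Proof.
move=> cC; apply: compact_closed => //; apply: continuous_compact => //.
by apply: continuous_subspaceT; exact: op_cont.
Qed.

(** Take [D] minimal among closed subsemigroups and [e] in [D]. Then [D e = D], so some [x] in [D]
    has [x e = e]; such [x] form a closed subsemigroup, hence all of [D], and [e] is one of them. *)
Lemma ellis_idempotent C : compact C -> C !=set0 ->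
  (forall x y, C x -> C y -> C (op x y)) -> exists2 e, C e & op e e = e.
Proof.
move=> cC Cn0 Cop.
have clC := compact_closed hT cC.
have [|D [DC clD Dn0 Dop Dmin]] := minimal_closed cC clC Cn0
    (P := [set C | forall x y, C x -> C y -> C (op x y)]) Cop.
  by move=> F FP x y Fx Fy A FA; apply: (FP _ FA); [exact: Fx|exact: Fy].
have cD : compact D by exact: subclosed_compact cC DC.
have [e De] := Dn0.
have De_eq : (op^~ e) @` D = D.
  apply: Dmin; first by move=> _ [x Dx <-]; exact: Dop.
  - exact: closed_opr.
  - by exists (op e e), e.
  - move=> _ _ [x Dx <-] [y Dy <-]; exists (op (op x e) y); last by rewrite !opA.
    by apply: (Dop) => //; exact: Dop.
have fixe : D `&` [set x | op x e = e] = D.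
  apply: Dmin; first by move=> x [].
  - apply: closedI => //.
    apply: ((continuous_closedP (op^~ e)).1 (@op_cont e) [set e]).
    exact/accessible_closed_set1/hausdorff_accessible.
  - by have : D e by []; rewrite -{1}De_eq => -[x Dx xe]; exists x.
  - by move=> x y [Dx xe] [Dy ye]; split; [exact: Dop|rewrite /= -opA ye].
exists e; first exact: DC.
by have : D e by []; rewrite -{1}fixe => -[].
Qed.

(* With [u] an idempotent in a minimal left ideal of [H] and [e] an idempotent
   of [I u], the idempotent [v = u e] lies below [u], so each retraction sends
   it to an idempotent of [H] below [u], that is, to [u]. *)
Lemma retract_idempotent H I (J : Type) (sigma : J -> T -> T) :
  compact H -> H !=set0 -> compact I -> I !=set0 ->
  (forall x y, H x -> H y -> H (op x y)) ->
  (forall x y, I x -> I y -> I (op x y)) ->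
  (forall x y, H x -> I y -> I (op x y)) ->
  (forall x y, I x -> H y -> I (op x y)) ->
  (forall a x y, sigma a (op x y) = op (sigma a x) (sigma a y)) ->
  (forall a x, I x -> H (sigma a x)) ->
  (forall a x, H x -> sigma a x = x) ->
  exists v, [/\ I v, op v v = v & forall a, op (sigma a v) v = v].
Proof.
move=> cH Hn0 cI In0 HH II HI IH sigmaM sigmaI sigmaH.
have [||L [LH clL Ln0 HL Lmin]] := minimal_closed cH (compact_closed hT cH) Hn0
    (P := [set C | forall x y, H x -> C y -> C (op x y)]).
- exact: HH.
- by move=> F FP x y Hx Fy A FA; apply: (FP _ FA) => //; exact: Fy.
have cL : compact L by exact: subclosed_compact cH LH.
have [u Lu uu] : exists2 u, L u & op u u = u.
  by apply: ellis_idempotent => // x y /LH Hx Ly; exact: HL.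
have Hu := LH _ Lu.
(* The left ideal [H p] is closed and inside [L], hence equal to [L] and contains [u]. *)
have Lp p : L p -> exists2 r, H r & op r p = u.
  move=> Lp; have E : (op^~ p) @` H = L.
    apply: Lmin; first by move=> _ [x Hx <-]; exact: HL.
    - exact: closed_opr.
    - by exists (op u p), u.
    - by move=> x _ Hx [y Hy <-]; exists (op x y); [exact: HH|rewrite !opA].
  by have := Lu; rewrite -E => -[r Hr <-]; exists r.
have [_ [x Ix <-] ee] : exists2 e, ((op^~ u) @` I) e & op e e = e.
  apply: ellis_idempotent.
  - apply: continuous_compact => //.
    by apply: continuous_subspaceT; exact: op_cont.
  - by have [x Ix] := In0; exists (op x u), x.
  - move=> _ _ [x Ix <-] [y Iy <-]; exists (op (op x u) y); last by rewrite !opA.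
    by apply: (II) => //; exact: IH.
pose e := op x u; rewrite -/e in ee.
have eu : op e u = e by rewrite /e -opA uu.
have Ie : I e by exact: IH.
pose v := op u e.
have vv : op v v = v by rewrite /v opA -(opA u e u) eu -opA ee.
have uv : op u v = v by rewrite /v opA uu.
have vu : op v u = v by rewrite /v -opA eu.
exists v; split=> // [|a]; first exact: HI.
pose p := sigma a v.
have Hp : H p by apply: sigmaI; exact: HI.
have pp : op p p = p by rewrite /p -sigmaM vv.
have up : op u p = p by rewrite /p -[in op u](sigmaH a _ Hu) -sigmaM uv.
have pu : op p u = p by rewrite /p -[in RHS]vu sigmaM (sigmaH a _ Hu).
have [r Hr rp] : exists2 r, H r & op r p = u.
  by apply: Lp; rewrite -pu; exact: HL.
have -> : sigma a v = u by rewrite -/p -up -rp -opA pp.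
exact: uv.
Qed.

End CompactSemigroup.

(** * Ultrafilters on words *)

Section Words.
Variables (X : finType) (v : X).
Implicit Types (a : X) (x y : seq X) (D E : set (seq X)).

(** The variable is itself one of the letters, because the induction on letters uses the last letter
    as the variable. *)
Definition subst a x : seq X := [seq if b == v then a else b | b <- x].

Lemma subst_cat a x y : subst a (x ++ y) = subst a x ++ subst a y.
Proof. exact: map_cat. Qed.

Lemma subst_var x : subst v x = x.
Proof.
by rewrite -[RHS]map_id; apply: eq_map => b; case: eqP.
Qed.

Lemma subst_const a x : v \notin x -> subst a x = x.
Proof.
move=> vx; rewrite -[RHS]map_id; apply/eq_in_map => b bx.
by case: eqP => // bv; rewrite -bv bx in vx.
Qed.

Lemma var_notin_subst a x : a != v -> v \notin subst a x.
Proof.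
move=> av; apply/mapP => -[b _]; case: eqP => [_ /esym|bv /esym//].
by move/eqP; rewrite (negbTE av).
Qed.

(* Families of sets of words as points of the compact space [2 ^ (2 ^ X^* )];
   [conv] extends concatenation to all of it. *)
Local Notation family := {ptws set (seq X) -> bool}.

Definition conv (p q : family) : family :=
  fun D => p [set x | q [set y | D (x ++ y)]].

Definition push a (p : family) : family := fun D => p [set x | D (subst a x)].

(** Each axiom is a condition on at most three coordinates, so that ultrafilters form a closed
    subset of the compact space. *)
Definition ultra (p : family) : Prop :=
  [/\ p setT, forall D, p (~` D) = ~~ p D &
      forall D E, p (D `&` E) = p D && p E].

Definition ultra_on E : set family := [set p | ultra p /\ p E].

Lemma ultraS p D E : ultra p -> D `<=` E -> p D -> p E.
Proof.
by case=> _ _ pI DE; rewrite -{1}(setIidl DE) pI => /andP[].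
Qed.

Lemma ultra_ex p D : ultra p -> p D -> D !=set0.
Proof.
move=> [pT pC _] pD; apply: contrapT => nD.
have D0 : D = set0 by rewrite -subset0 => x Dx; apply: nD; exists x.
by move: (pC D); rewrite pD D0 setC0 pT.
Qed.

Lemma ultra_bigI p (I : finType) (F : I -> set (seq X)) :
  ultra p -> (forall i, p (F i)) -> p [set x | forall i, F i x].
Proof.
move=> up pF; have [pT _ pI] := up.
have : p [set x | forall i, i \in enum I -> F i x].
  elim: (enum I) => [|i s IH]; first by apply: ultraS pT.
  apply: (@ultraS _ (F i `&` [set x | forall i, i \in s -> F i x])) => //.
    move=> x [Fix Fx] j; rewrite inE => /orP[/eqP->//|]; exact: Fx.
  by rewrite pI pF.
by apply: ultraS => // x Fx i; apply: Fx; rewrite mem_enum.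
Qed.

Lemma ultra_color p (l : nat) (f : seq X -> 'I_l) :
  ultra p -> exists i, p [set x | f x = i].
Proof.
move=> up; have [pT pC pI] := up; apply: contrapT => nf.
suff [x fx] : [set x | forall i, f x <> i] !=set0 by exact: (fx (f x)).
apply: (ultra_ex up); apply: ultra_bigI => // i.
have := pC [set x | f x = i]; rewrite /= => E.
rewrite -[X in p X]/(~` [set x | f x = i]) E.
by apply/negP => pi; apply: nf; exists i.
Qed.

Lemma convA : associative conv.
Proof.
move=> p q r; apply/funext => D; rewrite /conv.
congr (p _); apply/funext => x; congr (is_true (q _)); apply/funext => y.
by congr (is_true (r _)); apply/funext => z; rewrite /= catA.
Qed.

Lemma push_conv a p q : push a (conv p q) = conv (push a p) (push a q).
Proof.
apply/funext => D; rewrite /push /conv.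
congr (p _); apply/funext => x; congr (is_true (q _)); apply/funext => y.
by rewrite /= subst_cat.
Qed.

Lemma ultra_conv p q : ultra p -> ultra q -> ultra (conv p q).
Proof.
move=> [pT pC pI] [qT qC qI]; split.
- rewrite /conv; have -> : [set x | q [set y | setT (x ++ y)]] = setT; last by [].
  by apply/seteqP; split=> // x _.
- move=> D; rewrite /conv -pC; congr (p _); apply/funext => x /=.
  by rewrite (qC [set y | D (x ++ y)]); apply/propext; split=> /negP.
- move=> D E; rewrite /conv -pI; congr (p _); apply/funext => x /=.
  rewrite (qI [set y | D (x ++ y)] [set y | E (x ++ y)]).
  by apply/propext; split=> /andP.
Qed.

Lemma ultra_push a p : ultra p -> ultra (push a p).
Proof.
move=> [pT pC pI]; split=> [|D|D E] //; first by rewrite /push -pC.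
by rewrite /push -pI.
Qed.

Lemma ultra_on_conv D E F p q :
  (forall x y, D x -> E y -> F (x ++ y)) ->
  ultra_on D p -> ultra_on E q -> ultra_on F (conv p q).
Proof.
move=> DEF [up pD] [uq qE]; split; first exact: ultra_conv.
apply: ultraS pD => // x Dx /=; apply: ultraS qE => // y; exact: DEF.
Qed.

Lemma eval_cont D : continuous (fun p : family => p D).
Proof. exact: (@proj_continuous (set (seq X)) (fun=> bool) D). Qed.

(** The coordinate of [conv p q] at [D] is one coordinate of [p], at a set determined by [q] and
    [D]. *)
Lemma conv_cont q : continuous (conv^~ q).
Proof.
move=> p; have F := @fmap_filter _ _ (conv^~ q) _ (nbhs_filter p); apply/cvg_sup.
move=> D; apply/cvg_image; first by apply/seteqP; split=> // b _; exists (fun=> b).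
apply: cvg_trans (@eval_cont [set x | q [set y | D (x ++ y)]] p).
move=> U /= pU; exists ((fun r : family => r D) @^-1` U) => //.
by apply/seteqP; split=> [_ [r Ur <-]//|b Ub]; exists (fun=> b).
Qed.

Lemma closed_coord (h : bool -> bool -> bool -> bool) D E F :
  closed [set p : family | h (p D) (p E) (p F)].
Proof.
rewrite -openC openE => p nh.
have e G : nbhs p [set r : family | r G = p G].
  exact: (eval_cont (discrete_set1 (p G))).
by apply: filterS3 (e D) (e E) (e F) => r /= -> -> ->.
Qed.

Lemma family_hausdorff : hausdorff_space family.
Proof.
apply: hausdorff_product => D; exact: discrete_hausdorff.
Qed.

Lemma family_compact : compact [set: family].
Proof.
have := @tychonoff (set (seq X)) (fun=> bool) (fun=> setT) (fun=> bool_compact).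
by congr (compact _); apply/seteqP; split.
Qed.

Lemma ultra_on_compact E : compact (ultra_on E).
Proof.
apply: (subclosed_compact _ family_compact) => //.
rewrite (_ : ultra_on E = [set p | p setT && p E] `&`
   (\bigcap_D [set p | p (~` D) == ~~ p D]) `&`
   (\bigcap_DE [set p | p (DE.1 `&` DE.2) == p DE.1 && p DE.2])); last first.
  apply/seteqP; split=> [p [[pT pC pI] pE]|p [[/andP[pT pE] pC] pI]].
    by split=> [|D _]; [split=> [|D _]|]; rewrite /= ?pT ?pE ?pC ?pI.
  by split=> //; split=> // [D|D F]; apply/eqP; [exact: pC|exact: (pI (D, F))].
have c1 := @closed_coord (fun b c _ => b && c) setT E E.
have c2 : closed (\bigcap_D [set p : family | p (~` D) == ~~ p D]).
  apply: closed_bigI => D _.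
  exact: (@closed_coord (fun b c _ => b == ~~ c) (~` D) D D).
have c3 : closed (\bigcap_DE [set p : family | p (DE.1 `&` DE.2) == p DE.1 && p DE.2]).
  apply: closed_bigI => -[D F] _.
  exact: (@closed_coord (fun b c d => b == c && d) (D `&` F) D F).
exact: closedI (closedI c1 c2) c3.
Qed.

Definition principal x : family := fun D => `[< D x >].

Lemma principal_ultra_on x E : E x -> ultra_on E (principal x).
Proof.
move=> Ex; split; last exact/asboolP.
split=> [|D|D F]; first exact/asboolP.
  by rewrite /principal asbool_neg.
by rewrite /principal asbool_and.
Qed.

(** For [a] other than [v], [push a] maps ultrafilters on variable words to ultrafilters on constant
    words and fixes the latter, as [retract_idempotent] asks. Since [push v] is the identity, the
    case of [v] is idempotency. *)
Lemma word_idempotent : exists p : family,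
  [/\ ultra p, p [set x | v \in x] & forall a, conv (push a p) p = p].
Proof.
pose H := ultra_on [set x | v \notin x].
pose I := ultra_on [set x | v \in x].
have [|||||||||||p [[up pv] pp sp]] :=
  retract_idempotent family_hausdorff convA conv_cont (H := H) (I := I) (sigma := fun a : {a | a != v} => push (sval a)).
- exact: ultra_on_compact.
- by exists (principal [::]); exact: principal_ultra_on.
- exact: ultra_on_compact.
- by exists (principal [:: v]); apply: principal_ultra_on; rewrite /= inE.
- by move=> p q; apply: ultra_on_conv => x y /=; rewrite mem_cat negb_or => -> ->.
- by move=> p q; apply: ultra_on_conv => x y /=; rewrite mem_cat => ->.
- by move=> p q; apply: ultra_on_conv => x y /= _ yv; rewrite mem_cat yv orbT.
- by move=> p q; apply: ultra_on_conv => x y /=; rewrite mem_cat => ->.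
- by move=> a p q; exact: push_conv.
- move=> a p [up pv]; split; first exact: ultra_push.
  apply: (@ultraS p _ _ up _ pv) => x _; exact/var_notin_subst/(svalP a).
- move=> a p [up pv]; apply/funext => D; rewrite /push.
  have [_ _ pI] := up; rewrite -[LHS]andbT -[RHS]andbT -pv -!pI; congr (p _).
  by apply/seteqP; split=> x /= [] Dx vx; split=> //; move: Dx; rewrite subst_const.
exists p; split=> // a; have [->|av] := eqVneq a v; last exact: (sp (exist _ a av)).
have -> // : push v p = p.
apply/funext => D; rewrite /push.
by congr (p _); apply/funext => x; rewrite /= subst_var.
Qed.

(** Galvin-Glazer argument: [D] is a large set of admissible tails. As [conv (push a p) p = p], some
    variable word [w] in [D] leaves, for all letters [a] at once, a large set of [y] with
    [subst a w ++ y] in [D]; this is the next set of tails. *)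
Lemma monochromatic_subst_words (l : nat) (f : seq X -> 'I_l) :
  exists w : nat -> seq X, exists i, (forall m, v \in w m) /\
    forall m (a : nat -> X), a m = v ->
      f (flatten [seq subst (a k) (w k) | k <- iota 0 m.+1]) = i.
Proof.
have [p [up pv pp]] := word_idempotent.
have [i pi] := ultra_color f up.
have [_ _ pI] := up.
have step (D : {D : set (seq X) | p D}) : exists wE : seq X * {D : set (seq X) | p D},
   [/\ v \in wE.1, sval D wE.1 & forall a y, sval wE.2 y -> sval D (subst a wE.1 ++ y)].
  case: D => D pD /=.
  have pD' : p [set x | forall a, p [set y | D (subst a x ++ y)]].
    by apply: ultra_bigI => // a; move: (pD); rewrite -{1}(pp a).
  have : p (D `&` [set x | v \in x] `&`
      [set x | forall a, p [set y | D (subst a x ++ y)]]) by rewrite !pI pD pv.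
  move=> /(ultra_ex up)[w [[Dw vw] Hw]].
  exists (w, exist _ [set y | forall a, D (subst a w ++ y)] (ultra_bigI up Hw)).
  by split=> //= a y; apply.
have [s sP] := choice step.
pose D := fix D m : {D : set (seq X) | p D} :=
  if m is m'.+1 then (s (D m')).2 else exist (fun D : set (seq X) => p D) _ pi.
exists (fun m => (s (D m)).1), i; split=> [m|m a am]; first by have [] := sP (D m).
(* Blocks are added from the last one backwards; the last block is [w m] itself, which was chosen in
   [D m]. *)
suff : forall d n, n + d = m ->
  sval (D n) (flatten [seq subst (a k) (s (D k)).1 | k <- iota n d.+1]).
  by move=> /(_ m 0 (add0n _)).
elim=> [|d IH] n.
  by rewrite addn0 => -> /=; rewrite am subst_var cats0; have [] := sP (D m).
rewrite -addSnnS => /IH; have [_ _ H] := sP (D n).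
exact: H.
Qed.

End Words.

(** * Fusion *)

Lemma connection_ext L K (p q : connection L K) :
  surj p =1 surj q -> inj p =1 inj q -> p = q.
Proof.
case: p q => [s j H1 H2 H3] [s' j' H1' H2' H3'] /= /funext ss' /funext jj'.
by subst s' j'; f_equal; exact: Prop_irrelevance.
Qed.

Lemma conn_compA M L K J (p : connection K J) (q : connection L K)
    (r : connection M L) :
  conn_comp p (conn_comp q r) = conn_comp (conn_comp p q) r.
Proof. exact: connection_ext. Qed.

Definition conn_id : QQ := @Connection Omega Omega id id
  (fun x x' xx' => xx') (fun=> erefl) (fun x y yx => yx).

Section NatConnections.
Implicit Types (q r : QQ) (x y n m L : nat).

Lemma conn_inj_lt q x x' : x < x' -> inj q x < inj q x'.
Proof. exact: (inj_incr q). Qed.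

Lemma conn_inj_le q x x' : x <= x' -> inj q x <= inj q x'.
Proof. by rewrite leq_eqVlt => /orP[/eqP->//|/(conn_inj_lt q)/ltnW]. Qed.

Lemma leq_inj q x : x <= inj q x.
Proof.
by elim: x => // x IH; apply: (leq_ltn_trans IH); exact: conn_inj_lt.
Qed.

Lemma surj_leq q x y : y <= inj q x -> surj q y <= x.
Proof. exact: (@surj_le Omega Omega q x y). Qed.

Definition agree n L q r :=
  (forall x, x <= n -> inj q x = inj r x) /\
  (forall y, y < L -> surj q y = surj r y).

Definition agree_upto n q r := agree n (inj q n).+1 q r.

Lemma agree_trans n L q r t : agree n L q r -> agree n L r t -> agree n L q t.
Proof.
move=> [qr1 qr2] [rt1 rt2]; split=> [x xn|y yL].
  by rewrite qr1// rt1.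
by rewrite qr2// rt2.
Qed.

Lemma agree_sub n m L M q r : n <= m -> L <= M ->
  agree m M q r -> agree n L q r.
Proof.
move=> nm LM [qr1 qr2]; split=> [x xn|y yL].
  by apply: qr1; exact: leq_trans nm.
by apply: qr2; exact: leq_trans LM.
Qed.

Lemma agree_upto_sub n m q r : n <= m -> agree_upto m q r -> agree_upto n q r.
Proof. by move=> nm; apply: agree_sub => //; exact: conn_inj_le. Qed.

Lemma agree_upto_trans n q r t :
  agree_upto n q r -> agree_upto n r t -> agree_upto n q t.
Proof.
move=> qr rt; apply: (agree_trans qr).
by rewrite /agree_upto (qr.1 n (leqnn n)).
Qed.

(** A mark is never below its index, so agreement up to mark [n] freezes position [n] from stage [n]
    on, and the diagonal is coherent. *)
Lemma fusion_limit (q : nat -> QQ) :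
  (forall n, agree_upto n (q n) (q n.+1)) ->
  exists r, forall n, agree_upto n (q n) r.
Proof.
move=> qS.
have qM n m : n <= m -> agree_upto n (q n) (q m).
  elim: m => [|m IH]; first by rewrite leqn0 => /eqP->.
  rewrite leq_eqVlt => /orP[/eqP-> //|nm].
  apply: (agree_upto_trans (IH nm)).
  by apply: agree_upto_sub (qS m).
pose s y : nat := surj (q y) y.
pose j x : nat := inj (q x) x.
have jE x N : x <= N -> j x = inj (q N) x by move=> /qM[+ _]; exact.
have sE y N : y <= N -> s y = surj (q N) y.
  by move=> /qM[_]; apply; rewrite ltnS leq_inj.
have xj x : x <= j x by exact: leq_inj.
have j_lt x x' : x < x' -> j x < j x'.
  by move=> xx'; rewrite (jE x x' (ltnW xx')); exact: conn_inj_lt.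
have jK x : s (j x) = x by rewrite (sE _ (j x))// {2}(jE x (j x))// [LHS]injK.
have s_le x y : y <= j x -> s y <= x.
  move=> yjx; rewrite (sE _ (j x))//; apply: surj_leq.
  by rewrite -(jE x (j x)).
exists (@Connection Omega Omega s j j_lt jK s_le) => n; split=> [x xn|y yn] /=.
  by rewrite (jE _ n).
have [yn'|ny] := leqP y n; first by rewrite (sE _ n).
by have [_] := qM _ _ (ltnW ny); exact.
Qed.

(** Each instance of the criterion reads finitely many values, so it passes to limits in
    [reduct_limit]. *)
Lemma reductP q r : reduct q r <->
  (forall y, surj q y = surj q (inj r (surj r y))) /\
  (forall x, inj q x = inj r (surj r (inj q x))).
Proof.
split=> [[p ->]|[sq jq]]; first by split=> [y|x]; rewrite /= injK.
pose s y := surj q (inj r y).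
pose j x := surj r (inj q x).
have jK x : s (j x) = x by rewrite /s /j -sq [LHS]injK.
have j_lt x x' : x < x' -> j x < j x'.
  move=> /(conn_inj_lt q); rewrite (jq x) (jq x') => xx'; rewrite ltnNge.
  by apply/negP => /(conn_inj_le r); rewrite leqNgt xx'.
have s_le x y : y <= j x -> s y <= x.
  by move=> /(conn_inj_le r); rewrite /j -jq; exact: surj_leq.
exists (@Connection Omega Omega s j j_lt jK s_le).
by apply: connection_ext => [y|x] /=; rewrite ?/s ?/j -?sq -?jq.
Qed.

Lemma reduct_refl q : reduct q q.
Proof. by exists conn_id; exact: connection_ext. Qed.

Lemma reduct_trans q r t : reduct q r -> reduct r t -> reduct q t.
Proof. by move=> [p ->] [p' ->]; exists (conn_comp p p'); rewrite conn_compA. Qed.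

Lemma reduct_limit (q : nat -> QQ) r t n :
  (forall m, agree_upto m (q m) r) -> (forall m, n <= m -> reduct (q m) t) ->
  reduct r t.
Proof.
move=> qr qt.
have jE x N : x <= N -> inj r x = inj (q N) x by move=> xN; rewrite (qr N).1.
have sE y N : y <= N -> surj r y = surj (q N) y.
  by move=> yN; rewrite (qr N).2// ltnS (leq_trans yN)// leq_inj.
apply/reductP; split=> [y|x].
  pose N := maxn n (maxn y (inj t (surj t y))).
  have /qt/reductP[sq _] : n <= N by exact: leq_maxl.
  rewrite (sE _ N); last by rewrite /N !leq_max leqnn !orbT.
  by rewrite sq (sE _ N)// /N !leq_max leqnn !orbT.
pose N := maxn n x.
have /qt/reductP[_ jq] : n <= N by exact: leq_maxl.
by rewrite (jE _ N); [exact: jq|exact: leq_maxr].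
Qed.

(* [R] is the total relation when words are extended freely, and the relation
   of being a reduct when they are only thinned out. *)
Lemma fusion (R : QQ -> QQ -> Prop) (P : nat -> QQ -> Prop) :
  (forall q, R q q) -> (forall q r t, R q r -> R r t -> R q t) ->
  (forall (q : nat -> QQ) r, (forall n, agree_upto n (q n) r) ->
     (forall n m, n <= m -> R (q n) (q m)) -> forall n, R (q n) r) ->
  (forall n q r, P n q -> R q r -> agree_upto n.+1 q r -> P n r) ->
  (forall n q, exists r, [/\ R q r, agree_upto n q r & P n r]) ->
  exists q, forall n, P n q.
Proof.
move=> Rrefl Rtrans Rlim PR PE.
have [f fP] : exists f : nat -> QQ -> QQ, forall n q,
    [/\ R q (f n q), agree_upto n q (f n q) & P n (f n q)].
  have {}PE n : exists f, forall q, [/\ R q (f q), agree_upto n q (f q) & P n (f q)].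
    by have [f fP] := choice (PE n); exists f.
  by have [f fP] := choice PE; exists f.
pose q := fix q n := if n is n'.+1 then f n' (q n') else conn_id.
have qP n : [/\ R (q n) (q n.+1), agree_upto n (q n) (q n.+1) & P n (q n.+1)].
  exact: fP.
have [n|r qr] := @fusion_limit q; first by have [] := qP n.
(* [P n] is won by [q n.+1], which the limit follows up to mark [n.+1]; hence the index in the
   persistence hypothesis. *)
exists r => n; have [_ _ Pn] := qP n; apply: PR Pn _ (qr n.+1).
apply: Rlim => // k m; elim: m => [|m IH]; first by rewrite leqn0 => /eqP->.
rewrite leq_eqVlt => /orP[/eqP-> //|/IH km]; apply: Rtrans km _.
by have [] := qP m.
Qed.

End NatConnections.

Lemma finite_tasks (C : finType) (S : Type) (Inv : S -> Prop)
    (R : S -> S -> Prop) (P : C -> S -> Prop) :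
  (forall x, R x x) -> (forall x y z, R x y -> R y z -> R x z) ->
  (forall c x y, P c x -> R x y -> P c y) ->
  (forall c x, Inv x -> exists y, [/\ Inv y, R x y & P c y]) ->
  forall x, Inv x -> exists y, [/\ Inv y, R x y & forall c, P c y].
Proof.
move=> Rrefl Rtrans PR PE x Ix.
suff : exists y, [/\ Inv y, R x y & forall c, c \in enum C -> P c y].
  move=> [y [Iy xy Py]]; exists y; split=> // c; apply: Py.
  by rewrite mem_enum.
elim: (enum C) => [|c s [y [Iy xy Py]]]; first by exists x.
have [z [Iz yz Pz]] := PE c y Iy.
exists z; split=> // [|d]; first exact: Rtrans yz.
by rewrite inE => /orP[/eqP->//|/Py/PR]; exact.
Qed.

(** * Connections onto finitely many letters *)

Section FinConnections.
Variable k : nat.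
Implicit Types (p : FF k) (q : QQ).

Definition same L p p' :=
  inj p =1 inj p' /\ forall y : nat, y < L -> surj p y = surj p' y.

Lemma same_sym L p p' : same L p p' -> same L p' p.
Proof. by move=> [j s]; split=> [x|y /s]. Qed.

Lemma same_trans L p p' p'' : same L p p' -> same L p' p'' -> same L p p''.
Proof.
by move=> [j s] [j' s']; split=> [x|y yL]; [rewrite j|rewrite s// s'].
Qed.

Lemma same_sub L M p p' : L <= M -> same M p p' -> same L p p'.
Proof. by move=> LM [j s]; split=> // y yL; apply: s; exact: leq_trans LM. Qed.

Lemma inj_lt_ord p (x x' : 'I_k.+1) : x < x' -> inj p x < inj p x'.
Proof. exact: (inj_incr p). Qed.

Definition last_inj p : nat := inj p ord_max.

Lemma inj_last p (x : 'I_k.+1) : inj p x <= last_inj p.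
Proof.
have : x <= k by rewrite -ltnS.
rewrite leq_eqVlt => /orP[/eqP xk|xk]; last exact/ltnW/inj_lt_ord.
by rewrite /last_inj (_ : x = ord_max)//; exact: val_inj.
Qed.

Lemma surj_leq_ord p (x : 'I_k.+1) (y : nat) : y <= inj p x -> surj p y <= x.
Proof. exact: (@surj_le Omega (Fin k.+1) p x y). Qed.

Lemma comp_same n L p p' q q' : last_inj p <= n ->
  (forall y, y < L -> surj q y <= n) ->
  same n.+1 p p' -> agree n L q q' -> same L (conn_comp p q) (conn_comp p' q').
Proof.
move=> pn qn [jp sp] [jq sq]; split=> [x|y yL] /=.
  by rewrite -jp jq// (leq_trans _ pn)// inj_last.
by rewrite sp ?sq// ltnS -sq// qn.
Qed.

(** Up to [same n.+1] there are finitely many [p] with all marks at most [n]. They become tasks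
    indexed by [code]; a value that is the code of no such [p] gives a void task. *)
Lemma finite_patterns (S : Type) (Inv : S -> Prop) (R : S -> S -> Prop)
    (P : FF k -> S -> Prop) (n : nat) :
  (forall x, R x x) -> (forall x y z, R x y -> R y z -> R x z) ->
  (forall p x y, P p x -> R x y -> P p y) ->
  (forall p p' x, same n.+1 p p' -> P p x -> P p' x) ->
  (forall p x, last_inj p <= n -> Inv x -> exists y, [/\ Inv y, R x y & P p y]) ->
  forall x, Inv x ->
    exists y, [/\ Inv y, R x y & forall p, last_inj p <= n -> P p y].
Proof.
move=> Rrefl Rtrans PR Psame PE.
pose C : finType := ({ffun 'I_n.+1 -> 'I_k.+1} * {ffun 'I_k.+1 -> 'I_n.+1})%type.
pose code p : C := ([ffun y : 'I_n.+1 => surj p (y : nat)],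
                    [ffun x => inord (inj p x)]).
have codeE p p' : last_inj p <= n -> last_inj p' <= n -> code p = code p' ->
    same n.+1 p p'.
  move=> pn p'n [/ffunP s /ffunP j]; split=> [x|y yn].
    have := j x; rewrite !ffunE => /(congr1 val) /=; rewrite !inordK// ltnS.
      exact: leq_trans (inj_last _ _) p'n.
    exact: leq_trans (inj_last _ _) pn.
  by have := s (Ordinal yn); rewrite !ffunE.
have := @finite_tasks C S Inv R
  (fun c x => forall p, last_inj p <= n -> code p = c -> P p x) Rrefl Rtrans.
move=> H x Ix; have [|c y Iy|//|y [Iy xy Py]] := H _ _ x.
- by move=> c y z Py yz p pn pc; apply: PR yz; exact: Py.
- have [[p [pn pc]]|np] := pselect (exists p, last_inj p <= n /\ code p = c).
    have [z [Iz yz Pz]] := PE p y pn Iy.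
    exists z; split=> // p' p'n p'c; apply: Psame Pz; apply: codeE => //.
    by rewrite pc p'c.
  by exists y; split=> // p pn pc; exfalso; apply: np; exists p.
- by exists y; split=> // p pn; exact: Py.
Qed.

End FinConnections.

(** * The property of Baire *)

Section Baire.
Variable k : nat.
Implicit Types (p h : FF k) (q r : QQ) (n m L M : nat) (A : set (FF k)).

Lemma same_cylinder L p : exists (M : nat) (t : connection (Fin M) (Fin k.+1)),
  [/\ k.+1 < M, L <= M, cylinder t p & cylinder t `<=` same M p].
Proof.
pose M := (last_inj p + k.+1 + L).+1.
have jM (x : 'I_k.+1) : (inj p x : nat) < M.
  by rewrite ltnS -addnA (leq_trans (inj_last p x))// leq_addr.
pose i (x : 'I_k.+1) : 'I_M := Ordinal (jM x).
pose t (y : 'I_M) : 'I_k.+1 := surj p (y : nat).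
exists M, (@Connection (Fin M) (Fin k.+1) t i
  (fun x x' => @inj_lt_ord k p x x') (fun x => injK p x)
  (fun x y => @surj_leq_ord k p x y)).
split=> //=.
- by rewrite ltnS -addnA addnCA leq_addr.
- by rewrite leqW// leq_addl.
- by move=> p' [s j]; split=> [x|y yM]; [rewrite j|rewrite (s (Ordinal yM))].
Qed.

(** As [same] compares all marks whatever [L] is, a cylinder longer than [L] and the last mark fits
    inside. *)
Lemma nbhs_same p A : nbhs p A <-> exists L, forall p', same L p p' -> A p'.
Proof.
rewrite nbhsE; split=> [[B [[D Dcyl <-] [C DC Cp]] BA]|[L LA]].
  have [M [t [_ CE]]] := Dcyl _ DC.
  exists M => p' [j s]; apply: BA; exists C => //.
  move: Cp; rewrite CE => -[pt pi]; split=> [y|x]; first by rewrite -s.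
  by rewrite -j.
have [M [t [kM LM tp tM]]] := same_cylinder L p.
exists (cylinder t); last by move=> p' /tM /(same_sub LM); exact: LA.
split=> //; exists [set cylinder t]; last by rewrite bigcup_set1.
by move=> _ ->; exists M, t.
Qed.

(** Otherwise a whole neighborhood of [h] would lie in the closure of [N]. *)
Lemma nowhere_dense_avoid (N : set (FF k)) h L : nowhere_dense N ->
  exists h' L', [/\ L <= L', same L h h' & forall p, same L' h' p -> ~ N p].
Proof.
move=> N0; have : ~ interior (closure N) h by rewrite N0.
move=> nN; apply: contrapT => nh; apply: nN; rewrite /interior nbhs_same.
exists L => h' hh'; apply: contrapT => nN; apply: nh.
have [B [Bh' NB]] : exists B, nbhs h' B /\ ~ (N `&` B !=set0).
  apply: contrapT => nB; apply: nN => B Bh'; apply: contrapT => NB.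
  by apply: nB; exists B.
move/nbhs_same : Bh' => [L' L'B]; exists h', (maxn L L'); split=> //.
  exact: leq_maxl.
move=> p /(same_sub (leq_maxr _ _)) /L'B Bp Np; apply: NB.
by exists p.
Qed.

Definition decided (U : set (FF k)) h L :=
  (forall p, same L h p -> U p) \/ (forall p, same L h p -> ~ U p).

Lemma decide_open (U : set (FF k)) h L : open U ->
  exists h' L', [/\ L <= L', same L h h' & decided U h' L'].
Proof.
move=> oU; have [[h' [hh' Uh']]|nU] := pselect (exists h', same L h h' /\ U h').
  have /nbhs_same[L' L'U] : nbhs h' U by exact: open_nbhs_nbhs.
  exists h', (maxn L L'); split=> //; first exact: leq_maxl.
  by left=> p /(same_sub (leq_maxr _ _)); exact: L'U.
exists h, L; split=> //; right=> p hp Up; apply: nU; by exists p.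
Qed.

(* Keep [q] below [L], spell the values of [h] on [L, L') with the letters
   [inj p x <= n], and let the letter [n + 1] first occur at [L']. *)
Lemma extend_word n p h q L L' : last_inj p <= n -> inj q n < L -> L <= L' ->
  (forall y, y < L -> surj q y <= n) -> same L (conn_comp p q) h ->
  exists r, [/\ agree n L q r, forall y, y < L' -> surj r y <= n &
    forall p' r', same n.+1 p p' -> agree n L' r r' ->
      same L' h (conn_comp p' r')].
Proof.
move=> pn qn LL' qL [jh sh].
pose s (y : nat) : nat := if y < L then surj q y else
  if y < L' then inj p (surj h y) else n.+1 + (y - L').
pose j (x : nat) : nat := if x <= n then inj q x else L' + (x - n.+1).
have jL (x : nat) : x <= n -> inj q x < L.
  by move=> xn; exact: leq_ltn_trans (conn_inj_le q xn) qn.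
have pnx (x : 'I_k.+1) : inj p x <= n := leq_trans (inj_last p x) pn.
have j_lt (x x' : nat) : x < x' -> j x < j x'.
  rewrite /j => xx'; case: (leqP x' n) => x'n.
    by rewrite (ltnW (leq_trans xx' x'n)); exact: conn_inj_lt.
  by case: (leqP x n) => [/jL|]; lia.
have jK x : s (j x) = x.
  rewrite /s /j; case: (leqP x n) => [xn|nx]; first by rewrite jL// [LHS]injK.
  have -> : (L' + (x - n.+1) < L) = false by lia.
  have -> : (L' + (x - n.+1) < L') = false by lia.
  by lia.
have s_le (x y : nat) : y <= j x -> s y <= x.
  rewrite /s /j; case: (leqP x n) => [xn yx|nx yx].
    by rewrite (leq_ltn_trans yx (jL _ xn)); exact: surj_leq.
  case: ifP => [/qL|yL]; first by lia.
  case: ifP => yL'; last by lia.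
  exact: ltnW (leq_ltn_trans (pnx _) nx).
have s_n (y : nat) : y < L' -> s y <= n.
  by rewrite /s => ->; case: ifP => [/qL//|_]; exact: pnx.
pose r : QQ := @Connection Omega Omega s j j_lt jK s_le.
exists r; split=> //.
  by split=> [x xn|y yL] /=; [rewrite /j xn|rewrite /s yL].
move=> p' r' [jp sp] [jr sr]; split=> [x|y yL'] /=.
  by rewrite -jp -jr// -jh /= /j pnx.
rewrite -sr//= -sp; last exact: s_n.
rewrite /s yL'; case: ifP => [yL|_]; first by rewrite -sh.
(* The letter written at [y] is the mark [inj p (surj h y)], which [surj p] sends back to
   [surj h y]. *)
by rewrite [RHS]injK.
Qed.

Section Fusion.
Variables (l : nat) (U : 'I_l -> set (FF k)) (N : 'I_l -> nat -> set (FF k)).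
Hypothesis oU : forall a, open (U a).
Hypothesis N0 : forall a m, nowhere_dense (N a m).

Definition settled n h L := forall c : 'I_l * 'I_n.+1,
  (forall p, same L h p -> ~ N c.1 c.2 p) /\ decided (U c.1) h L.

Lemma settle n h L : exists h' L', [/\ L <= L', same L h h' & settled n h' L'].
Proof.
have [||[c1 c2] [h1 L1] [h2 L2] [NP D] [/= L12 h12]|[a m] [h1 L1] _|//|] :=
  @finite_tasks ('I_l * 'I_n.+1)%type (FF k * nat) (fun=> True)
  (fun x y => x.2 <= y.2 /\ same x.2 x.1 y.1)
  (fun c x => (forall p, same x.2 x.1 p -> ~ N c.1 c.2 p) /\
     decided (U c.1) x.1 x.2) _ _ _ _ (h, L).
- by move=> x; split.
- move=> x y z [xy1 xy2] [yz1 yz2]; split; first exact: leq_trans yz1.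
  by apply: (same_trans xy2); exact: same_sub yz2.
- have sub p : same L2 h2 p -> same L1 h1 p.
    by move=> /(same_sub L12); exact: same_trans.
  split=> [p /sub|]; first exact: NP.
  by case: D => D; [left|right] => p /sub; exact: D.
- have [h2 [L2 [L12 h12 NP]]] := nowhere_dense_avoid h1 L1 (@N0 a m).
  have [h3 [L3 [L23 h23 D]]] := decide_open h2 L2 (oU a).
  exists (h3, L3); split=> //=.
    split; first exact: leq_trans L23.
    by apply: (same_trans h12); exact: same_sub h23.
  split=> // p h3p; apply: NP; apply: (same_trans h23); exact: same_sub h3p.
- by move=> [h' L'] [_ [LL' hh'] H]; exists h', L'.
Qed.

(** In a state [(q, L)] only the first [L] values of [q] are committed. Stage [n] runs through the
    patterns with marks at most [n] and lengthens the committed word until each composite is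
    settled. *)
Lemma settled_fusion : exists q, forall p n, last_inj p <= n ->
  exists h L, settled n h L /\
    forall p', same n.+1 p p' -> same L h (conn_comp p' q).
Proof.
pose task n p (x : QQ * nat) := exists h L, settled n h L /\
  forall p' q', same n.+1 p p' -> agree n x.2 x.1 q' ->
    same L h (conn_comp p' q').
have [|||||q qP] := @fusion (fun _ _ => True) (fun n q => exists2 L,
    L <= inj q n.+1 & forall p, last_inj p <= n -> task n p (q, L)).
- by [].
- by [].
- by [].
- move=> n q r [L Lq H] _ qr; exists L; first by rewrite -qr.1.
  move=> p /H[h [L' [hL' HL']]]; exists h, L'; split=> // p' q' pp' /= rq'.
  apply: HL' => //=; apply: agree_trans rq'; apply: agree_sub qr => //.
  exact: leqW.
- move=> n q.
  (* The letter [n.+1] has not occurred yet, so [extend_word] applies. *)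
  pose Inv (x : QQ * nat) :=
    inj x.1 n < x.2 /\ forall y : nat, y < x.2 -> surj x.1 y <= n.
  have [||||||[r L] [[/= rL rn] [/= qL qr] H]] := @finite_patterns k (QQ * nat) Inv
    (fun x y => x.2 <= y.2 /\ agree n x.2 x.1 y.1) (task n) n _ _ _ _ _
    (q, (inj q n).+1).
  + by move=> x; split.
  + move=> x y z [xy1 xy2] [yz1 yz2]; split; first exact: leq_trans yz1.
    by apply: (agree_trans xy2); exact: agree_sub yz2.
  + move=> p x y [h [L [hL H]]] [xy1 xy2]; exists h, L; split=> //.
    move=> p' q' pp' yq'; apply: H => //; apply: (agree_trans xy2).
    exact: agree_sub yq'.
  + move=> p p' x pp' [h [L [hL H]]]; exists h, L; split=> // p'' q' p'p''.
    by apply: H; exact: same_trans p'p''.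
  + move=> p [q1 L1] pn [/= qL1 qn].
    have [h [L2 [L12 qh hL2]]] := settle n (conn_comp p q1) L1.
    have [r [q1r rn H]] := extend_word pn qL1 L12 qn qh.
    exists (r, L2); split=> //=.
      by split=> //=; rewrite -q1r.1//; exact: leq_trans L12.
    by exists h, L2.
  + by split=> //= y; rewrite ltnS; exact: surj_leq.
  exists r; split=> //; exists L => //.
  (* If mark [n.+1] were below [L], the value there would exceed [n]. *)
  rewrite leqNgt; apply/negP => /rn; rewrite [X in X <= _]injK ltnn //.
exists q => p n pn; have [L _ /(_ p pn)[h [L' [hL' H]]]] := qP n.
by exists h, L'; split=> // p' pp'; apply: H.
Qed.

End Fusion.

(* On the reducts of the fusion, each color class agrees with an open set. *)
Lemma baire_reduct l (g : FF k -> 'I_l) : baire_measurable g ->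
  exists q, forall p p', same (last_inj p).+1 p p' ->
    g (conn_comp p q) = g (conn_comp p' q).
Proof.
move=> hg.
have [U hU] := choice hg.
have [N hN] : exists N : 'I_l -> nat -> set (FF k), forall a,
    (forall m, nowhere_dense (N a m)) /\
    (g @^-1` [set a]) `+` U a `<=` \bigcup_m N a m.
  have H a : exists N : nat -> set (FF k), (forall m, nowhere_dense (N m)) /\
      (g @^-1` [set a]) `+` U a `<=` \bigcup_m N m by exact: (hU a).2.
  by have [N hN] := choice H; exists N.
have [q qP] := @settled_fusion l U N (fun a => (hU a).1) (fun a => (hN a).1).
(* Stage [maxn (last_inj p) m] makes [conn_comp p q] avoid [N a m], for every [m]; so it lies
   outside the meager symmetric difference. *)
have gU p a : g (conn_comp p q) = a <-> U a (conn_comp p q).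
  have nN m : ~ N a m (conn_comp p q).
    have [h [L [hL hp]]] := qP p (maxn (last_inj p) m) (leq_maxl _ _).
    have mn : m < (maxn (last_inj p) m).+1 by rewrite ltnS leq_maxr.
    by have [+ _] := hL (a, Ordinal mn); apply; exact: hp.
  have nD : ~ ((g @^-1` [set a]) `+` U a) (conn_comp p q).
    by move=> /(hN a).2[m _]; exact: nN.
  split=> gp; apply: contrapT => np; apply: nD; first by left.
  by right.
exists q => p p' pp'; set a := g (conn_comp p q).
(* At stage [last_inj p] both composites lie in one neighborhood, which decides [U a]. *)
have [h [L [hL hp]]] := qP p _ (leqnn _).
have [_ D] := hL (a, ord0).
have Up : U a (conn_comp p q) by exact/gU.
apply/esym/gU; case: D => D; first exact/D/hp.
by case: (D (conn_comp p q) _ Up); exact: hp.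
Qed.

End Baire.

(** * Induction on the number of letters *)

Section LastOccurrence.
Variables (X : eqType) (v : X).
Implicit Types x y : seq X.

(* Equal to [size x] if [v] does not occur in [x]. *)
Fixpoint last_index x : nat :=
  if x is b :: x' then
    if (b == v) && (v \notin x') then 0 else (last_index x').+1
  else 0.

(** If [v] is absent, the index is [size x], where [nth] returns its default [v]. *)
Lemma nth_last_index x : nth v x (last_index x) = v.
Proof. by elim: x => //= b x IH; case: ifP => // /andP[/eqP]. Qed.

Lemma last_index_cat x y : v \in y -> last_index (x ++ y) = size x + last_index y.
Proof.
by move=> vy; elim: x => //= b x ->; rewrite mem_cat vy orbT andbF.
Qed.

Lemma last_index_lt x : v \in x -> last_index x < size x.
Proof.
elim: x => //= b x IH; rewrite inE eq_sym.
by case: (b == v) => /=; [case: ifP => // /negbFE /IH|move=> /IH].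
Qed.

End LastOccurrence.

Definition depends_below_last k l (g : FF k -> 'I_l) : Prop :=
  forall p p', same (last_inj p).+1 p p' -> g p = g p'.

Lemma depends_comp k l (g : FF k -> 'I_l) (q : QQ) :
  depends_below_last g -> depends_below_last (fun p => g (conn_comp p q)).
Proof.
move=> gd p p' pp'; apply: gd; apply: comp_same (leqnn _) _ pp' _ => //.
by move=> y; rewrite ltnS; exact: surj_leq.
Qed.

Lemma conn_of_increasing (c : nat -> nat) : (forall x, c x < c x.+1) ->
  exists q : QQ, inj q =1 c.
Proof.
move=> cS.
have c_lt (x x' : nat) : x < x' -> c x < c x'.
  elim: x' => // x' IH; rewrite ltnS leq_eqVlt => /orP[/eqP->//|/IH xx'].
  exact: ltn_trans (cS _).
have c_ge x : x <= c x by elim: x => // x IH; exact: leq_ltn_trans (cS x).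
have ex y : exists x, y <= c x by exists y.
pose s y := ex_minn (ex y).
have s_le (x y : nat) : y <= c x -> s y <= x.
  by rewrite /s; case: ex_minnP => m _; exact.
have cK x : s (c x) = x.
  apply/eqP; rewrite eqn_leq s_le//= /s; case: ex_minnP => m cm _.
  by rewrite leqNgt; apply/negP => /c_lt; rewrite ltnNge cm.
by exists (@Connection Omega Omega s c c_lt cK s_le).
Qed.

Lemma infinite_color (l : nat) (f : nat -> 'I_l) :
  exists a, forall N, exists2 n, N <= n & f n = a.
Proof.
apply: contrapT => H.
have {}H a : exists N, forall n, N <= n -> f n <> a.
  apply: contrapT => nN; apply: H; exists a => N; apply: contrapT => nn.
  by apply: nN; exists N => n Nn fn; apply: nn; exists n.
have [N NP] := choice H.
by have := NP (f (\max_a N a)) _ (leq_bigmax (f (\max_a N a))).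
Qed.

(** With one letter only the position of the mark matters; [q] puts its marks at infinitely many
    positions of one color. *)
Lemma pigeonhole_case l (g : FF 0 -> 'I_l) : depends_below_last g ->
  exists (q : QQ) a, forall p, g (conn_comp p q) = a.
Proof.
move=> gd.
have lt0 (n : nat) (x x' : 'I_1) : x < x' -> n < n by rewrite !ord1.
have K0 (x : 'I_1) : (ord0 : 'I_1) = x by rewrite ord1.
pose point n : FF 0 := @Connection Omega (Fin 1) (fun=> ord0) (fun=> n)
  (@lt0 n) K0 (fun x y _ => leq0n x).
have [a aP] := infinite_color (fun n => g (point n)).
have {}aP N : exists n, N <= n /\ g (point n) = a.
  by have [n] := aP N; exists n.
have [next nextP] := choice aP.
pose c := fix c x := if x is x'.+1 then next (c x').+1 else next 0.
have [|q qc] := @conn_of_increasing c; first by move=> x; have [] := nextP (c x).+1.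
exists q, a => p; have <- : g (point (c (inj p ord0))) = a.
  by case: (inj p ord0) => [|x] /=; [have [] := nextP 0|have [] := nextP (c x).+1].
apply: gd; split=> [x|y _] /=; first by rewrite qc (ord1 x).
by rewrite [LHS]ord1.
Qed.

(** * Adding a last letter *)

Section Extension.
Variable k : nat.
Implicit Types (p : FF k) (q r : QQ).

Let widen (x : 'I_k.+1) : 'I_k.+2 := widen_ord (leqnSn k.+1) x.

(** Values of [p] after its last mark are ignored: there [e] carries a free word over all [k.+2]
    letters. *)
Definition extends p (e : FF k.+1) :=
  (forall x : 'I_k.+1, inj e (widen x) = inj p x) /\
  (forall y : nat, y <= last_inj p -> surj e y = widen (surj p y)).

Lemma extends_same p p' e : same (last_inj p).+1 p p' -> extends p e ->
  extends p' e.
Proof.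
move=> [jp sp] [je se]; split=> [x|y yn]; first by rewrite je jp.
have yn' : y <= last_inj p by rewrite /last_inj jp.
by rewrite se// sp.
Qed.

Lemma extends_last p e : extends p e -> last_inj p < last_inj e.
Proof.
by move=> [je _]; rewrite /last_inj -je; exact/inj_lt_ord/ltnSn.
Qed.

Lemma extends_comp p e q : agree (last_inj p) (last_inj p).+1 conn_id q ->
  extends p e -> extends p (conn_comp e q).
Proof.
move=> [jq sq] [je se]; split=> [x|y yn] /=.
  by rewrite je -jq//; exact: inj_last.
by rewrite -sq//=; exact: se.
Qed.

(** Merge the last letter into the one before it. Up to the mark of the latter nothing changes, and
    merging commutes with composing with [q]. *)
Lemma restriction (e : FF k.+1) : exists p,
  forall q, extends (conn_comp p q) (conn_comp e q).
Proof.
pose s y : 'I_k.+1 := inord (minn (surj e y) k).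
pose j (x : 'I_k.+1) : nat := inj e (widen x).
have sE (y : nat) : s y = minn (surj e y) k :> nat.
  by rewrite /s inordK// ltnS geq_minr.
have jK x : s (j x) = x.
  apply: val_inj; rewrite /= sE /j injK /=.
  by apply/minn_idPl; rewrite -ltnS.
have j_lt (x x' : 'I_k.+1) : x < x' -> j x < j x'.
  exact: (@inj_lt_ord _ e (widen x) (widen x')).
have s_le (x : 'I_k.+1) (y : nat) : y <= j x -> s y <= x.
  by move=> yx; rewrite sE geq_min (@surj_leq_ord _ e (widen x) y yx).
pose p : FF k := @Connection Omega (Fin k.+1) s j j_lt jK s_le.
exists p => q; split=> // y yn; apply: val_inj; rewrite /= sE.
apply/esym/minn_idPl.
exact: (@surj_leq_ord _ (conn_comp e q) (widen ord_max) y).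
Qed.

Let v : 'I_k.+2 := ord_max.

Lemma ord_widen (z : 'I_k.+2) : z != v -> widen (inord z) = z.
Proof.
move=> zv; apply: val_inj; rewrite /= inordK// ltn_neqAle -ltnS ltn_ord andbT.
by apply: contraNneq zv => zk; apply/eqP/val_inj.
Qed.

(** After [x] the default of [nth] continues with [v] forever. The mark of [v] sits at its last
    occurrence in [x] because substitution may also create earlier ones. *)
Lemma extend_by_word p (x : seq 'I_k.+2) : exists e : FF k.+1,
  [/\ extends p e, last_inj e = (last_inj p).+1 + last_index v x &
    forall i, surj e ((last_inj p).+1 + i) = nth v x i].
Proof.
set n := last_inj p.
pose s (y : nat) : 'I_k.+2 := if y <= n then widen (surj p y) else nth v x (y - n.+1).
pose j (z : 'I_k.+2) : nat := if z == v then n.+1 + last_index v x else inj p (inord z).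
have jn z : z != v -> j z <= n by rewrite /j => /negbTE ->; exact: inj_last.
have jv : j v = n.+1 + last_index v x by rewrite /j eqxx.
have inord_val (z : 'I_k.+2) : z != v -> (inord z : 'I_k.+1) = z :> nat.
  by move=> /ord_widen /(congr1 val).
have jK z : s (j z) = z.
  rewrite /s; have [->|zv] := eqVneq z v.
    by rewrite jv leqNgt leq_addr /= addKn nth_last_index.
  by rewrite jn// /j (negbTE zv) injK ord_widen.
have j_lt (z z' : 'I_k.+2) : z < z' -> j z < j z'.
  move=> zz'; have zv : z != v.
    by rewrite -val_eqE /= neq_ltn (leq_trans zz')// -ltnS.
  have [->|z'v] := eqVneq z' v; first by
    rewrite jv ltnS (leq_trans (jn _ zv))// leq_addr.
  by rewrite /j (negbTE zv) (negbTE z'v); apply: inj_lt_ord; rewrite !inord_val.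
have s_le (z : 'I_k.+2) (y : nat) : y <= j z -> s y <= z.
  have [->|zv] := eqVneq z v; first by move=> _; rewrite -ltnS ltn_ord.
  move=> yz; rewrite /s (leq_trans yz (jn _ zv)) /= -(inord_val z zv).
  by apply: surj_leq_ord; move: yz; rewrite /j (negbTE zv).
exists (@Connection Omega (Fin k.+2) s j j_lt jK s_le); split=> //.
- split=> [z|y yn] /=; last by rewrite /s yn.
  have zv : widen z != v by rewrite -val_eqE /= neq_ltn ltn_ord.
  rewrite /j (negbTE zv); congr (inj p _); apply: val_inj.
  by rewrite /= inordK.
- by move=> i; rewrite /= /s leqNgt leq_addr /= addKn.
Qed.

Section WordReduct.
Variables (p : FF k) (w : nat -> seq 'I_k.+2).
Hypothesis vw : forall m, v \in w m.
Let n := last_inj p.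

(** In block [m] the variable becomes a fresh letter [n.+1 + m], and any other [b] becomes its mark
    in [p], which every extension of [p] reads as [b]. *)
Let letter m (b : 'I_k.+2) : nat := if b == v then n.+1 + m else inj p (inord b).
Let W m : seq nat := flatten [seq [seq letter i b | b <- w i] | i <- iota 0 m].
(** By [leq_sizeW] the default [0] is never read. *)
Let u i := nth 0 (W i.+1) i.
Let j m := size (W m) + last_index v (w m).

Let WS m : W m.+1 = W m ++ [seq letter m b | b <- w m].
Proof. by rewrite /W -[m.+1]addn1 iotaD map_cat flatten_cat /= cats0. Qed.

Let leq_sizeW m : m <= size (W m).
Proof.
elim: m => // m IH; rewrite WS size_cat size_map -[m.+1]addn1; apply: leq_add => //.
by case: (w m) (vw m).
Qed.

Let uE m i : i < size (W m) -> u i = nth 0 (W m) i.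
Proof.
have stable m' d : i < size (W m') -> nth 0 (W (m' + d)) i = nth 0 (W m') i.
  elim: d => [|d IH] im; first by rewrite addn0.
  have id : i < size (W (m' + d)).
    elim: {IH} d => [|d IH]; first by rewrite addn0.
    by rewrite addnS WS size_cat ltn_addr.
  by rewrite addnS WS nth_cat id IH.
move=> im; have [mi|/ltnW im'] := leqP m i.+1.
  by rewrite /u -(subnKC mi) stable.
by rewrite -(subnKC im') stable.
Qed.

Let j_ltW m : j m < size (W m.+1).
Proof. by rewrite WS size_cat size_map ltn_add2l last_index_lt. Qed.

Let u_j m : u (j m) = n.+1 + m.
Proof.
rewrite (uE (j_ltW m)) WS nth_cat ltnNge leq_addr /= addKn.
by rewrite (nth_map v) ?last_index_lt// nth_last_index /letter eqxx.
Qed.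

Let u_le m i : i <= j m -> u i <= n.+1 + m.
Proof.
move=> /leq_ltn_trans/(_ (j_ltW m)) im; rewrite (uE im).
move: (mem_nth 0 im); move: (nth _ _ _) => c /flattenP[_ /mapP[m' + ->]].
rewrite mem_iota add0n ltnS => /andP[_ m'm] /mapP[b _ ->]; rewrite /letter.
case: ifP => _; first by rewrite leq_add2l.
by rewrite (leq_trans (inj_last p _))// -/n addSn -addnS leq_addr.
Qed.

(** [q] is the identity up to [n] and then spells [u]. Reading it through [e] substitutes the value
    of [e] at [n.+1 + i] into [w i]; the last mark of [e] selects [m], and block [m] receives
    [v]. *)
Lemma word_reduct : exists q, agree n n.+1 conn_id q /\
  forall e, extends p e -> exists (m : nat) (a : nat -> 'I_k.+2), a m = v /\
  forall e', let x := flatten [seq subst v (a i) (w i) | i <- iota 0 m.+1] in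
    extends p e' -> last_inj e' = n.+1 + last_index v x ->
    (forall i, surj e' (n.+1 + i) = nth v x i) ->
    same (last_inj e').+1 e' (conn_comp e q).
Proof.
pose s (y : nat) : nat := if y <= n then y else u (y - n.+1).
pose c (x : nat) : nat := if x <= n then x else n.+1 + j (x - n.+1).
have jS m : j m < j m.+1 by apply: leq_trans (j_ltW m) _; exact: leq_addr.
have c_lt (x x' : nat) : x < x' -> c x < c x'.
  have j_lt m m' : m < m' -> j m < j m'.
    elim: m' => // m' IH; rewrite ltnS leq_eqVlt => /orP[/eqP->//|/IH mm'].
    exact: ltn_trans (jS m').
  rewrite /c => xx'; case: (leqP x' n) => x'n; first by
    rewrite (ltnW (leq_trans xx' x'n)).
  case: (leqP x n) => xn; first by lia.
  by rewrite ltn_add2l; apply: j_lt; lia.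
have cK x : s (c x) = x.
  rewrite /s /c; case: (leqP x n) => [->//|nx].
  by rewrite leqNgt leq_addr /= addKn u_j subnKC.
have s_le (x y : nat) : y <= c x -> s y <= x.
  rewrite /s /c; case: (leqP x n) => xn yx; first by rewrite (leq_trans yx xn).
  case: (leqP y n) => yn; first by lia.
  by have := @u_le (x - n.+1) (y - n.+1); rewrite subnKC//; apply; lia.
exists (@Connection Omega Omega s c c_lt cK s_le); split.
  by split=> [x xn|y yn] /=; [rewrite /c xn|rewrite /s -ltnS yn].
move=> e pe; pose m := last_inj e - n.+1.
have em : n.+1 + m = last_inj e by rewrite subnKC// extends_last.
pose a i : 'I_k.+2 := surj e (n.+1 + i).
have am : a m = v by rewrite /a em; exact: (injK e).
exists m, a; split=> // e' x pe' e'x e's.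
have WE m' : [seq surj e (y : nat) | y <- W m'] =
    flatten [seq subst v (a i) (w i) | i <- iota 0 m'].
  rewrite /W map_flatten -map_comp; congr flatten; apply: eq_map => i /=.
  rewrite -map_comp; apply: eq_map => b /=; rewrite /letter.
  case: eqP => [//|/eqP bv]; rewrite -pe.1 [LHS](injK e).
  exact: ord_widen.
have xE : x = [seq surj e (y : nat) | y <- W m] ++ w m.
  by rewrite /x -[m.+1]addn1 iotaD map_cat flatten_cat /= cats0 -WE am subst_var.
(* The last block keeps its variable, so the last [v] of [x] lies in it. *)
have jx : j m = last_index v x by rewrite xE last_index_cat// size_map.
split=> [z|y]; last first.
  rewrite ltnS e'x -jx => yj; rewrite /= /s; case: leqP => yn.
    by rewrite pe'.2// pe.2.
  rewrite -{1}(subnKC yn) e's (@uE m.+1); last first.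
    by apply: leq_ltn_trans (j_ltW m); rewrite leq_subLR.
  rewrite /x -WE (nth_map 0)//; apply: leq_ltn_trans (j_ltW m).
  by rewrite leq_subLR.
rewrite /=; have [->|zv] := eqVneq z v.
  by rewrite [LHS]e'x -[inj e v]/(last_inj e) -em /c leqNgt leq_addr /= addKn jx.
rewrite -(ord_widen zv) pe.1 pe'.1 /c.
by rewrite (inj_last p).
Qed.

End WordReduct.

(** Color a word [x] by the color of the extension of [p] by [x]. Up to its last mark,
    [conn_comp e q] looks like the extension by a substituted concatenation, all of which share one
    color. *)
Lemma color_extensions l (g : FF k.+1 -> 'I_l) p : depends_below_last g ->
  exists q, agree (last_inj p) (last_inj p).+1 conn_id q /\
    exists a, forall e, extends p e -> g (conn_comp e q) = a.
Proof.
move=> gd.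
have [ext extP] := choice (extend_by_word p).
have [w [a [vw wa]]] := monochromatic_subst_words v (fun x => g (ext x)).
have [q [pq qP]] := word_reduct p vw.
exists q; split=> //; exists a => e pe.
have [m [b [bm bP]]] := qP e pe.
rewrite -(wa m b bm); apply/esym/gd.
by case: (extP (flatten [seq subst v (b i) (w i) | i <- iota 0 m.+1])); exact: bP.
Qed.

Lemma color_extensions_fusion l (g : FF k.+1 -> 'I_l) : depends_below_last g ->
  exists q, forall p, exists a, forall e, extends p e -> g (conn_comp e q) = a.
Proof.
move=> gd.
(* Stage [n] treats only last marks equal to [n]; smaller ones had their own stage. *)
pose P n p q := last_inj p = n ->
  exists a, forall e, extends p e -> g (conn_comp e q) = a.
(* If [r] is [t] followed by [q] and agrees with [q] up to [n], then [t] is the identity up to [n],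
   so [conn_comp e t] still extends [p]. *)
have PR n p q r : P n p q -> reduct r q -> agree_upto n q r -> P n p r.
  move=> H [t ->] qr pn; have [a aP] := H pn; exists a => e pe.
  rewrite conn_compA; apply: aP; apply: extends_comp pe; rewrite pn.
  split=> [x xn|y yn] /=.
    by have := qr.1 x xn => /(congr1 (surj q)); rewrite /= !injK.
  have := qr.2 (inj q y); rewrite /= !injK => <- //.
  by rewrite ltnS; exact: conn_inj_le.
have [|||||q qP] := @fusion (fun q r => reduct r q)
  (fun n q => forall p, last_inj p <= n -> P n p q).
- exact: reduct_refl.
- by move=> q r t qr rt; exact: reduct_trans qr.
- by move=> q r qr qq n; apply: (reduct_limit qr) => m; exact: qq.
- move=> n q r H rq qr p pn; apply: PR (H p pn) rq _.
  exact: agree_upto_sub qr.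
- move=> n q.
  have [||||||r [_ [rq qr] H]] := @finite_patterns k QQ (fun=> True)
    (fun q r => reduct r q /\ agree_upto n q r) (P n) n _ _ _ _ _ q.
  + by move=> r; split; [exact: reduct_refl|].
  + move=> r1 r2 r3 [r21 a21] [r32 a32]; split; first exact: reduct_trans r21.
    exact: agree_upto_trans a32.
  + by move=> p r1 r2 H [r21 a21]; exact: PR a21.
  + move=> p p' r pp' H p'n.
    have pn : last_inj p = n by rewrite /last_inj pp'.1.
    have [a aP] := H pn; exists a => e p'e; apply: aP.
    apply: extends_same p'e; apply: same_sym; rewrite p'n; move: pp'; exact.
  + move=> p r pn _.
    have [pn'|pn'] := eqVneq (last_inj p) n; last first.
      exists r; split=> //; first by split; [exact: reduct_refl|].
      by move=> E; rewrite E eqxx in pn'.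
    have [t [[jt st] [a aP]]] := color_extensions p (depends_comp r gd).
    rewrite pn' in jt st.
    exists (conn_comp t r); split=> //; last first.
      by move=> _; exists a => e pe; rewrite conn_compA; exact: aP.
    split; first by exists t.
    split=> [x xn|y yn] /=; first by rewrite -jt.
    by rewrite -st//= ltnS; exact: surj_leq.
  + by [].
  by exists r.
by exists q => p; exact: (qP _ p (leqnn _)).
Qed.

End Extension.

(** [g1 p] is the common color of the extensions of [p], to which induction applies; any [e] extends
    its restriction, even after composing both with [q2]. *)
Lemma monochromatic_reducts k l (g : FF k -> 'I_l) : depends_below_last g ->
  exists (q : QQ) a, forall p, g (conn_comp p q) = a.
Proof.
elim: k g => [|k IH] g gd; first exact: pigeonhole_case.
have [q1 q1P] := color_extensions_fusion gd.
have [g1 g1P] := choice q1P.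
have [|q2 [a aP]] := IH g1.
  (* The empty word serves only to provide some extension of [p]. *)
  move=> p p' pp'; have [e [pe _ _]] := extend_by_word p [::].
  by rewrite -(g1P p e pe); apply: g1P; exact: extends_same pe.
exists (conn_comp q2 q1), a => e; have [p pP] := restriction e.
by rewrite conn_compA -(aP p); apply: g1P; exact: pP.
Qed.

Theorem theorem7 (K l : nat) (hl : 0 < l)
    (g : connection Omega (Fin K) -> 'I_l) (hg : baire_measurable g) :
  exists q : connection Omega Omega, monochromatic g (reducts (Fin K) q).
Proof.
case: K g hg => [|k] g hg.
  (* For [K = 0] there is no connection, since [surj p 0] would be an element of the empty type. *)
  by exists conn_id, (Ordinal hl) => p; case: (surj p 0).
have [q0 q0P] := baire_reduct hg.
have [q1 [a aP]] := monochromatic_reducts q0P.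
by exists (conn_comp q1 q0), a => _ [p ->]; rewrite conn_compA; exact: aP.
Qed.
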